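(* Let $S$ be a sample graph with $p$ nodes, and let the automorphism group $\mathrm{Aut}(S)$ act on the set of the $p!$ total orderings of the nodes of $S$ by $\mu\cdot(X_1,\ldots,X_p)=(\mu(X_1),\ldots,\mu(X_p))$. Choose exactly one representative ordering from each equivalence class (orbit) of this action. Then, for every data graph $G$, applying to $G$ the conjunctive queries $Q_\pi$, one for each chosen representative ordering $\pi$, discovers every instance of $S$ in $G$ exactly once: for each instance $H$ of $S$ in $G$ there is exactly one pair consisting of a chosen ordering $\pi$ and a solution of $Q_\pi$ in $G$ whose image is $H$.
   Context: Graphs are finite, simple and undirected. The nodes of the data graph $G$ are totally ordered by $<$, and the edge relation $E$ contains the tuple $(a,b)$ if and only if $\{a,b\}$ is an edge of $G$ and $a<b$. An instance of $S$ in $G$ is a (not necessarily induced) subgraph of $G$ isomorphic to $S$. For an ordering $\pi=(X_1,X_2,\ldots,X_p)$ of the nodes of $S$, the conjunctive query $Q_\pi$ has one variable for each node of $S$ and is the conjunction of: a relational subgoal $E(X_i,X_j)$ for each edge $\{X_i,X_j\}$ of $S$ with $i<j$; and the arithmetic subgoals $X_i<X_{i+1}$ for $i=1,\ldots,p-1$. A solution of $Q_\pi$ in $G$ is an assignment of nodes of $G$ to the variables satisfying all subgoals; its image is the subgraph of $G$ formed by the assigned nodes and the edges of $G$ that correspond to the edges of $S$. An automorphism of $S$ is a bijection from its nodes to its nodes that preserves the presence of an edge. *)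

(* Defs.v *)
From mathcomp Require Import all_boot all_order all_fingroup.
From mathcomp Require Import primitive_action.

Set Implicit Arguments.
Unset Strict Implicit.
Unset Printing Implicit Defensive.

Record sgraph (V : finType) := SGraph {
  edge :> rel V;
  edge_sym : symmetric edge;
  edge_irr : irreflexive edge
}.

Definition edges (V : finType) (S : sgraph V) : {set {set V}} :=
  [set [set e.1; e.2] | e : V * V & S e.1 e.2].

(* A candidate subgraph is a pair (node set, set of edges), each edge being the
   unordered pair of its ends, so that equality of subgraphs is equality of
   pairs. *)
Definition node_edge_sets (N : finType) : predArgType :=
  ({set N} * {set {set N}})%type.

Definition is_subgraph (N : finType) (G : sgraph N) (H : node_edge_sets N) :=
  H.2 \subset edges G /\ (forall e, e \in H.2 -> e \subset H.1).

Definition isomorphic_to (V N : finType) (S : sgraph V)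
    (H : node_edge_sets N) :=
  exists phi : V -> N,
    [/\ injective phi, phi @: [set: V] = H.1
      & forall x y : V, ([set phi x; phi y] \in H.2) = S x y].

Definition instance (V N : finType) (S : sgraph V) (G : sgraph N)
    (H : node_edge_sets N) :=
  is_subgraph G H /\ isomorphic_to S H.

Section Automorphisms.

Variables (V : finType) (S : sgraph V).

Definition graph_aut : {set {perm V}} :=
  [set mu : {perm V} | [forall x, forall y, S (mu x) (mu y) == S x y]].

Lemma graph_aut_group_set : group_set graph_aut.
Proof.
apply/group_setP; split=> [|mu nu].
  by rewrite inE; apply/forallP=> x; apply/forallP=> y; rewrite !perm1.
rewrite !inE => /forallP muS /forallP nuS.
apply/forallP=> x; apply/forallP=> y; rewrite !permM.
by rewrite (eqP (forallP (nuS _) _)) (eqP (forallP (muS _) _)).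
Qed.

Canonical graph_aut_group := Group graph_aut_group_set.

End Automorphisms.

(* When #|V| = p, a p-tuple without repetition lists every node once. *)
Definition orderings (V : finType) (p : nat) : {set p.-tuple V} :=
  p.-dtuple([set: V]).

(* The action ('P * p) maps (X_1, .., X_p) to (mu X_1, .., mu X_p). *)
Definition ordering_classes (V : finType) (S : sgraph V) (p : nat) :
    {set {set p.-tuple V}} :=
  [set orbit ('P * p)%act (graph_aut S) pi | pi in orderings V p].

Variant subgoal (V : Type) :=
  | Relational of V & V
  | Arithmetic of V & V.

(* The variables of the query are the nodes of S themselves. *)
Definition cquery (V : finType) (S : sgraph V) (p : nat) (pi : p.-tuple V) :
    seq (subgoal V) :=
  [seq Relational (tnth pi ij.1) (tnth pi ij.2) |
     ij : 'I_p * 'I_p <- enum {: 'I_p * 'I_p}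
     & (ij.1 < ij.2)%N && S (tnth pi ij.1) (tnth pi ij.2)]
  ++
  [seq Arithmetic (tnth pi ij.1) (tnth pi ij.2) |
     ij : 'I_p * 'I_p <- enum {: 'I_p * 'I_p}
     & ij.2 == ij.1.+1 :> nat].

Section Solutions.

Variables (d : Order.disp_t) (N : finOrderType d) (G : sgraph N) (V : finType).

Definition edge_relation (a b : N) : bool := G a b && (a < b)%O.

Definition satisfies (f : {ffun V -> N}) (g : subgoal V) : bool :=
  match g with
  | Relational X Y => edge_relation (f X) (f Y)
  | Arithmetic X Y => (f X < f Y)%O
  end.

Definition solution (Q : seq (subgoal V)) (f : {ffun V -> N}) : bool :=
  all (satisfies f) Q.

(* For a solution of a query of S, the sets [f @: e] are edges of G. *)
Definition image_subgraph (S : sgraph V) (f : {ffun V -> N}) :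
    node_edge_sets N :=
  (f @: [set: V], [set f @: (e : {set V}) | e in edges S]).

End Solutions.

(* Main.v *)
(* A solution with image H lists the nodes of H in increasing order.  Pulling
   the increasing enumeration of H back along an embedding of S onto H gives an
   ordering of S, and two such embeddings differ by an automorphism of S.  So H
   determines exactly one class of orderings, and once the representative is
   fixed the enumeration of H determines the solution. *)
Require Import Defs.
From mathcomp Require Import all_boot all_order all_fingroup.
From mathcomp Require Import primitive_action.

Lemma imset_pair {aT rT : finType} (f : aT -> rT) (x y : aT) :
  f @: [set x; y] = [set f x; f y].
Proof. by rewrite imsetU1 imset_set1. Qed.

(** An unordered pair forgets its orientation, which symmetry restores; irreflexivity excludes the
    degenerate pairs. *)
Lemma mem_edges {V : finType} (S : sgraph V) (x y : V) :
  ([set x; y] \in edges S) = S x y.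
Proof.
apply/imsetP/idP=> [[[a b]]|xy]; last by exists (x, y); rewrite ?inE.
rewrite inE /= => ab Exy; move: ab.
have /set2P[->|->]: a \in [set x; y] by rewrite Exy set21.
  by have /set2P[->|->]: b \in [set x; y]; rewrite ?edge_irr // Exy set22.
have /set2P[->|->]: b \in [set x; y]; rewrite ?edge_irr // 1?edge_sym //.
by rewrite Exy set22.
Qed.

Lemma edgesP {V : finType} {S : sgraph V} {e : {set V}} :
  reflect (exists x y, S x y /\ e = [set x; y]) (e \in edges S).
Proof.
apply: (iffP idP) => [|[x [y [xy ->]]]]; last by rewrite mem_edges.
by case/imsetP=> -[x y]; rewrite inE /= => xy ->; exists x, y.
Qed.

Lemma mem_image_subgraph {d : Order.disp_t} {N : finOrderType d} {V : finType}
    (S : sgraph V) (f : {ffun V -> N}) (x y : V) :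
  injective f -> ([set f x; f y] \in (image_subgraph S f).2) = S x y.
Proof.
move=> f_inj; rewrite -imset_pair /= mem_imset ?mem_edges //.
exact: imset_inj.
Qed.

Lemma mem_ordering {V : finType} {p : nat} (pi : p.-tuple V) :
  #|V| = p -> pi \in orderings V p -> forall x, x \in pi.
Proof.
move=> hp; rewrite inE => /andP[pi_uniq _] x.
have /subset_cardP/(_ (subset_predT _))-> // : #|pi| = #|V|.
by rewrite (card_uniqP pi_uniq) size_tuple.
Qed.

Lemma all_enumP {T : finType} {U : Type} (g : T -> U) (c : pred T)
    (a : pred U) :
  reflect (forall x, c x -> a (g x)) (all a [seq g x | x <- enum T & c x]).
Proof.
rewrite all_map all_filter; apply: (iffP allP) => [ga x cx|ga x _].
  by apply: (implyP (ga x _)) => //; rewrite mem_enum.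
exact/implyP/ga.
Qed.

(** Replaces the query by order and adjacency conditions. Since [f] increases along [pi], the
    orientation demanded by [edge_relation] holds automatically, so only preservation of edges
    remains. *)
Lemma solution_cqueryP {d : Order.disp_t} {N : finOrderType d} (G : sgraph N)
    {V : finType} (S : sgraph V) {p : nat} (pi : p.-tuple V)
    (f : {ffun V -> N}) :
  #|V| = p -> pi \in orderings V p ->
  reflect (sorted <%O (map f pi) /\ {homo f : x y / S x y >-> G x y})
          (solution G (cquery S pi) f).
Proof.
move=> hp pi_ord; rewrite /solution /cquery all_cat.
apply: (iffP andP) => [[/all_enumP/= rel /all_enumP/= arith]|[f_lt f_hom]].
  have relE (i j : 'I_p) : i < j -> S (tnth pi i) (tnth pi j) ->
      G (f (tnth pi i)) (f (tnth pi j)).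
    by move=> ij Sij; have := rel (i, j); rewrite /= ij Sij => /(_ isT)/andP[].
  split=> [|x y].
    (* A node is needed as default value for [nth]; if there is none, [pi] is empty. *)
    have [x0 _|V0] := pickP V; last first.
      by case: (tval pi) => // x; have := V0 x.
    apply/(sortedP (f x0)) => i; rewrite size_map size_tuple => ip.
    have := arith (Ordinal (ltnW ip), Ordinal ip) (eqxx _).
    by rewrite !(tnth_nth x0) !(nth_map x0) ?size_tuple //; apply: ltnW.
  have /tnthP[i ->] := mem_ordering pi hp pi_ord x.
  have /tnthP[j ->] := mem_ordering pi hp pi_ord y.
  (* Relational subgoals exist only for [i < j]; symmetry of [S] and [G] covers [j < i]. *)
  case: (ltngtP i j) => [|ji|/ord_inj->]; first exact: relE.
    by rewrite edge_sym => Sji; rewrite edge_sym; apply: relE.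
  by rewrite edge_irr.
have f_mono (i j : 'I_p) : i < j -> (f (tnth pi i) < f (tnth pi j))%O.
  move=> ij; rewrite -!(tnth_map f) !(tnth_nth (f (tnth pi i))).
  apply: (sorted_ltn_nth Order.POrderTheory.lt_trans) => //;
    by rewrite inE size_tuple.
split; apply/all_enumP=> -[i j] /=.
  by case/andP=> ij Sij; rewrite /edge_relation f_hom ?f_mono.
by move=> /eqP ij; apply: f_mono; rewrite ij.
Qed.

Lemma sorted_map_injective {d : Order.disp_t} {N : finOrderType d}
    {V : finType} {p : nat} (pi : p.-tuple V) (f : V -> N) :
  (forall x, x \in pi) -> sorted <%O (map f pi) -> injective f.
Proof.
move=> pi_all /Order.POrderTheory.lt_sorted_uniq f_uniq x y.
have /tnthP[i ->] := pi_all x; have /tnthP[j ->] := pi_all y.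
by rewrite -!(tnth_map f) => /(tuple_uniqP _ f_uniq)->.
Qed.

Lemma transversal_orbit_exists {V : finType} {S : sgraph V} {p : nat}
    {R : {set p.-tuple V}} (s : p.-tuple V) :
  is_transversal R (ordering_classes S p) (orderings V p) ->
  s \in orderings V p ->
  exists2 mu, mu \in graph_aut S & n_act 'P s mu \in R.
Proof.
case/and3P=> _ _ /forall_inP hR s_ord.
have /hR/cards1P[t] :
    orbit ('P * p)%act (graph_aut S) s \in ordering_classes S p.
  exact: imset_f.
move/setP/(_ t); rewrite set11 inE => /andP[tR /orbitP[mu muS def_t]].
by exists mu; rewrite // def_t.
Qed.

(** Both orderings lie in the intersection of [R] with a single orbit, which is a singleton. *)
Lemma transversal_orbit_inj {V : finType} {S : sgraph V} {p : nat}
    {R : {set p.-tuple V}} (s : p.-tuple V) (mu : {perm V}) :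
  is_transversal R (ordering_classes S p) (orderings V p) ->
  s \in R -> mu \in graph_aut S -> n_act 'P s mu \in R -> n_act 'P s mu = s.
Proof.
case/and3P=> _ /subsetP R_ord /forall_inP hR sR muS muR.
have /hR/cards1P[t /setP Rt] :
    orbit ('P * p)%act (graph_aut S) s \in ordering_classes S p.
  by apply: imset_f; apply: R_ord.
have /set1P def_s : s \in [set t] by rewrite -Rt inE sR; apply: orbit_refl.
rewrite [RHS]def_s; apply/set1P; rewrite -Rt inE muR.
exact: (mem_orbit ('P * p)%act).
Qed.

Theorem theorem3p1 (p : nat) (V : finType) (S : sgraph V) (hp : #|V| = p)
    (R : {set p.-tuple V})
    (hR : is_transversal R (ordering_classes S p) (orderings V p))
    (d : Order.disp_t) (N : finOrderType d) (G : sgraph N)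
    (H : node_edge_sets N) (hH : instance S G H) :
  exists! pif : p.-tuple V * {ffun V -> N},
    [/\ pif.1 \in R,
        solution G (cquery S pif.1) pif.2
      & image_subgraph S pif.2 = H].
Proof.
have R_ord : {subset R <= orderings V p} by apply/subsetP; case/and3P: hR.
case: hH => -[/subsetP HG H_sub] [phi [phi_inj phiV phiS]].
apply/unique_existence; split.
  (* Existence: the nodes of [S] are listed by increasing image under [phi], then moved by [mu] to
     the representative of their class. *)
  pose t := sort (relpre phi <=%O) (enum V).
  have t_size : size t == p by rewrite size_sort -cardE hp.
  have t_ord : Tuple t_size \in orderings V p.
    by rewrite inE sort_uniq enum_uniq /=; apply/subsetP=> x; rewrite inE.
  have [mu muS muR] := transversal_orbit_exists _ hR t_ord.
  (* Precomposing with the inverse of [mu] makes [f] take along the representative the same values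
     as [phi] along [t]. *)
  pose f := [ffun x => phi ((mu^-1)%g x)].
  have f_mu x : f (mu x) = phi x by rewrite ffunE permK.
  have muVS x y : S ((mu^-1)%g x) ((mu^-1)%g y) = S x y.
    have := groupVr muS; rewrite inE => /forallP/(_ x)/forallP/(_ y)/eqP.
    exact.
  exists (n_act 'P (Tuple t_size) mu, f); split=> //=.
    apply/solution_cqueryP=> //; first exact: R_ord.
    split=> [|x y Sxy].
      rewrite -map_comp (eq_map f_mu) -sort_map.
      by rewrite Order.TotalTheory.sort_lt_sorted map_inj_uniq ?enum_uniq.
    by rewrite -mem_edges HG // !ffunE phiS muVS.
  case: H phiV phiS HG H_sub => HN HE /= phiV phiS HG H_sub; congr pair.
    rewrite -phiV; apply/setP=> n; apply/imsetP/imsetP=> -[x _ ->].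
      by exists ((mu^-1)%g x); rewrite ?ffunE.
    by exists (mu x); rewrite ?f_mu.
  apply/setP=> e; apply/imsetP/idP=> [[_ /edgesP[x [y [Sxy ->]]] ->]|eH].
    by rewrite imset_pair !ffunE phiS muVS.
  (* As an edge of [G], [e] has two ends; both are nodes of [H], hence values of [phi]. *)
  have /edgesP[a [b [_ def_e]]] := HG e eH.
  have /subsetP e_sub := H_sub e eH; rewrite -phiV def_e in e_sub.
  have /imsetP[x _ def_a] := e_sub a (set21 a b).
  have /imsetP[y _ def_b] := e_sub b (set22 a b).
  exists [set mu x; mu y]; last by rewrite imset_pair !f_mu def_e def_a def_b.
  by rewrite mem_edges -muVS !permK -phiS -def_a -def_b -def_e.
move=> [pi f] [pi' f'] /= [piR sol im] [piR' sol' im'].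
have pi_all := mem_ordering _ hp (R_ord _ piR).
have pi_all' := mem_ordering _ hp (R_ord _ piR').
have [f_lt _] := elimT (solution_cqueryP _ _ _ _ hp (R_ord _ piR)) sol.
have [f_lt' _] := elimT (solution_cqueryP _ _ _ _ hp (R_ord _ piR')) sol'.
have f_inj := sorted_map_injective _ _ pi_all f_lt.
have f_inj' := sorted_map_injective _ _ pi_all' f_lt'.
have eq_im : f @: [set: V] = f' @: [set: V].
  by rewrite -[LHS]/((image_subgraph S f).1) im -im'.
(* Both lists are the strictly increasing enumeration of the nodes of [H]. *)
have eq_f : map f pi = map f' pi'.
  apply: Order.POrderTheory.lt_sorted_eq => // n.
  have /setP/(_ n) := eq_im => im_n.
  apply/mapP/mapP=> -[x _ def_n].
    have /imsetP[y _ ->] : n \in f' @: [set: V] by rewrite -im_n def_n imset_f.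
    by exists y.
  have /imsetP[y _ ->] : n \in f @: [set: V] by rewrite im_n def_n imset_f.
  by exists y.
have f_codom x : f x \in codom f'.
  have /imsetP[y _ ->] : f x \in f' @: [set: V] by rewrite -eq_im imset_f.
  exact: codom_f.
(* The comparison map is [f] followed by the inverse of [f'], defined because both have the same
   range. *)
have mu_inj : injective (fun x => iinv (f_codom x)).
  by move=> x y /(congr1 f'); rewrite !f_iinv => /f_inj.
pose mu := perm mu_inj.
have f_mu x : f' (mu x) = f x by rewrite permE f_iinv.
have muS : mu \in graph_aut S.
  rewrite inE; apply/forallP=> x; apply/forallP=> y.
  (* Adjacency in [S] can be read off from the edges of [H] through either embedding. *)
  rewrite -(mem_image_subgraph S f' _ _ f_inj') !f_mu im' -im.
  by rewrite mem_image_subgraph.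
have def_pi' : pi' = n_act 'P pi mu.
  (* Cancelling the injective [f'] turns equality of the two enumerations into equality of
     orderings. *)
  apply/val_inj/(inj_map f_inj') => /=.
  by rewrite -eq_f -map_comp; apply: eq_map => x /=; rewrite -f_mu.
have eq_pi : pi' = pi.
  by rewrite def_pi' (transversal_orbit_inj _ _ hR) // -def_pi'.
congr pair; first by [].
(* With equal orderings, [f] and [f'] agree on every entry of [pi], and [pi] contains every node. *)
apply/ffunP=> x; move: eq_f; rewrite eq_pi => /eq_in_map; exact.
Qed.
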